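(* Let $F\colon\mathcal{C}\to\mathcal{D}$ and $G\colon\mathcal{D}\to\mathcal{C}$ be functors. Then $G$ is a right adjoint of $F$ if and only if $G=\mathrm{Lan}_F(\mathrm{id}_{\mathcal{C}})$ (that is, $G$, equipped with some natural transformation $\eta\colon\mathrm{id}_{\mathcal{C}}\Rightarrow G\circ F$, is the left Kan extension of $\mathrm{id}_{\mathcal{C}}$ along $F$) and this Kan extension is preserved by $F$. In this case, $F\dashv\mathrm{Lan}_F(\mathrm{id}_{\mathcal{C}})$ and the natural transformation $\eta\colon\mathrm{id}_{\mathcal{C}}\Rightarrow\mathrm{Lan}_F(\mathrm{id}_{\mathcal{C}})\circ F$ is the unit of the adjunction.
   Context: All categories are locally small. Given functors $F\colon\mathcal{C}\to\mathcal{E}$ and $K\colon\mathcal{C}\to\mathcal{D}$, a (left) Kan extension of $F$ along $K$ is a functor $G\colon\mathcal{D}\to\mathcal{E}$ together with a natural transformation $\eta\colon F\Rightarrow G\circ K$ such that for any other pair $(G'\colon\mathcal{D}\to\mathcal{E},\ \eta'\colon F\Rightarrow G'\circ K)$ there is a unique natural transformation $\alpha\colon G\Rightarrow G'$ with $\eta'=\alpha_K\circ\eta$, where $(\alpha_K)_C=\alpha_{K(C)}$. It is unique up to natural isomorphism and denoted $\mathrm{Lan}_K(F)$. A functor $H\colon\mathcal{E}\to\mathcal{F}$ preserves the Kan extension $(\mathrm{Lan}_K(F),\eta)$ if the pair $(H\circ\mathrm{Lan}_K(F),H(\eta))$ is the Kan extension of $H\circ F$ along $K$, where $H(\eta)_C=H(\eta_C)$.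 *)

(* Defs.v *)
Set Implicit Arguments.
Unset Strict Implicit.
Unset Printing Implicit Defensive.

Declare Scope cat_scope.
Delimit Scope cat_scope with cat.
Open Scope cat_scope.

(* Objects and morphisms live in two independent universe levels, so the class
   of objects may be large while all hom-sets are of one fixed size: this is
   local smallness. Equality of morphisms is Leibniz equality. *)
Record category : Type := Category {
  obj :> Type;
  hom : obj -> obj -> Type;
  idm : forall x, hom x x;
  comp : forall x y z, hom y z -> hom x y -> hom x z;
  comp_idl : forall x y (f : hom x y), comp (idm y) f = f;
  comp_idr : forall x y (f : hom x y), comp f (idm x) = f;
  comp_assoc : forall w x y z (h : hom y z) (g : hom x y) (f : hom w x),
    comp h (comp g f) = comp (comp h g) f
}.

Arguments hom {c} x y.
Arguments idm {c} x.
Arguments comp {c x y z} g f.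
Arguments comp_idl {c x y} f.
Arguments comp_idr {c x y} f.
Arguments comp_assoc {c w x y z} h g f.

Notation "g ∘ f" := (comp g f) (at level 40, left associativity) : cat_scope.

Record functor (C D : category) : Type := Functor {
  fobj :> C -> D;
  fmap : forall x y, hom x y -> hom (fobj x) (fobj y);
  fmap_id : forall x, fmap (idm x) = idm (fobj x);
  fmap_comp : forall x y z (g : hom y z) (f : hom x y),
    fmap (g ∘ f) = fmap g ∘ fmap f
}.

Arguments fmap {C D} F {x y} f : rename.
Arguments fmap_id {C D} F x : rename.
Arguments fmap_comp {C D} F {x y z} g f : rename.

Definition functor_id (C : category) : functor C C :=
  @Functor C C (fun x => x) (fun _ _ f => f)
    (fun _ => eq_refl) (fun _ _ _ _ _ => eq_refl).

Lemma functor_comp_id (C D E : category) (G : functor D E) (F : functor C D)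
    (x : C) : fmap G (fmap F (idm x)) = idm (G (F x)).
Proof. rewrite fmap_id; apply fmap_id. Qed.

Lemma functor_comp_comp (C D E : category) (G : functor D E) (F : functor C D)
    (x y z : C) (g : hom y z) (f : hom x y) :
  fmap G (fmap F (g ∘ f)) = fmap G (fmap F g) ∘ fmap G (fmap F f).
Proof. rewrite fmap_comp; apply fmap_comp. Qed.

Definition functor_comp (C D E : category)
    (G : functor D E) (F : functor C D) : functor C E :=
  @Functor C E (fun x => G (F x)) (fun _ _ f => fmap G (fmap F f))
    (functor_comp_id G F) (functor_comp_comp G F).

Notation "G ∘F F" := (functor_comp G F)
  (at level 40, left associativity) : cat_scope.

Record nat_trans (C D : category) (F G : functor C D) : Type := NatTrans {
  component :> forall x : C, hom (F x) (G x);
  naturality : forall (x y : C) (f : hom x y),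
    component y ∘ fmap F f = fmap G f ∘ component x
}.

Notation "F ⇒ G" := (nat_trans F G) (at level 70) : cat_scope.

Lemma nt_comp_naturality (C D : category) (F G H : functor C D)
    (b : G ⇒ H) (a : F ⇒ G) (x y : C) (f : hom x y) :
  (b y ∘ a y) ∘ fmap F f = fmap H f ∘ (b x ∘ a x).
Proof.
now rewrite <- comp_assoc, naturality, comp_assoc, naturality, comp_assoc.
Qed.

Definition nt_comp (C D : category) (F G H : functor C D)
    (b : G ⇒ H) (a : F ⇒ G) : F ⇒ H :=
  @NatTrans C D F H (fun x => b x ∘ a x) (nt_comp_naturality b a).

(* [nt_restrict a K] is the transformation a_K, with (a_K)_x = a_(K x). *)
Definition nt_restrict (C D E : category) (G G' : functor D E)
    (a : G ⇒ G') (K : functor C D) : G ∘F K ⇒ G' ∘F K :=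
  @NatTrans C E (G ∘F K) (G' ∘F K) (fun x => a (K x))
    (fun _ _ f => naturality a (fmap K f)).

Lemma nt_image_naturality (C D E E' : category) (H : functor E E')
    (K : functor C D) (F : functor C E) (G : functor D E)
    (eta : F ⇒ G ∘F K) (x y : C) (f : hom x y) :
  fmap H (eta y) ∘ fmap (H ∘F F) f
  = fmap ((H ∘F G) ∘F K) f ∘ fmap H (eta x).
Proof.
simpl; rewrite <- !fmap_comp; apply f_equal; exact (naturality eta f).
Qed.

(* The transformation H(eta), with H(eta)_x = H(eta_x). Its codomain is
   bracketed as (H G) K, rather than H (G K), because functor composition is
   not associative up to conversion. *)
Definition nt_image (C D E E' : category) (H : functor E E')
    (K : functor C D) (F : functor C E) (G : functor D E)
    (eta : F ⇒ G ∘F K) : H ∘F F ⇒ (H ∘F G) ∘F K :=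
  @NatTrans C E' (H ∘F F) ((H ∘F G) ∘F K) (fun x => fmap H (eta x))
    (nt_image_naturality H eta).

Definition is_left_kan (C D E : category) (K : functor C D) (F : functor C E)
    (G : functor D E) (eta : F ⇒ G ∘F K) : Prop :=
  forall (G' : functor D E) (eta' : F ⇒ G' ∘F K),
    exists! a : G ⇒ G', eta' = nt_comp (nt_restrict a K) eta.

Definition preserves_left_kan (C D E E' : category) (H : functor E E')
    (K : functor C D) (F : functor C E) (G : functor D E)
    (eta : F ⇒ G ∘F K) : Prop :=
  is_left_kan (nt_image H eta).

(* Adjunctions F -| G as bijections hom (F c) d <-> hom c (G d) that are
   natural in both c and d. *)
Record adjunction (C D : category) (F : functor C D) (G : functor D C) : Type :=
  Adjunction {
  transpose : forall (c : C) (d : D), hom (F c) d -> hom c (G d);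
  untranspose : forall (c : C) (d : D), hom c (G d) -> hom (F c) d;
  transposeK : forall (c : C) (d : D) (f : hom (F c) d),
    untranspose (transpose f) = f;
  untransposeK : forall (c : C) (d : D) (g : hom c (G d)),
    transpose (untranspose g) = g;
  transpose_natl : forall (c c' : C) (d : D) (u : hom c' c) (f : hom (F c) d),
    transpose (f ∘ fmap F u) = transpose f ∘ u;
  transpose_natr : forall (c : C) (d d' : D) (v : hom d d') (f : hom (F c) d),
    transpose (v ∘ f) = fmap G v ∘ transpose f
}.

Arguments transpose {C D F G} a {c d} f : rename.
Arguments untranspose {C D F G} a {c d} g : rename.

Definition is_right_adjoint (C D : category)
    (G : functor D C) (F : functor C D) : Prop := inhabited (adjunction F G).

Lemma adj_unit_naturality (C D : category) (F : functor C D) (G : functor D C)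
    (A : adjunction F G) (x y : C) (f : hom x y) :
  transpose A (idm (F y)) ∘ fmap (functor_id C) f
  = fmap (G ∘F F) f ∘ transpose A (idm (F x)).
Proof.
simpl; rewrite <- transpose_natl, <- transpose_natr.
now rewrite comp_idl, comp_idr.
Qed.

Definition adj_unit (C D : category) (F : functor C D) (G : functor D C)
    (A : adjunction F G) : functor_id C ⇒ G ∘F F :=
  @NatTrans C C (functor_id C) (G ∘F F) (fun c => transpose A (idm (F c)))
    (adj_unit_naturality A).

(* Main.v *)
Require Import Defs.
From Stdlib Require Import FunctionalExtensionality ProofIrrelevance.

Set Implicit Arguments.
Unset Strict Implicit.

(** The theorem is a passage between the two triangle identities and the two
    Kan extensions.

    If [F ⊣ G] with unit [η] and counit [ε], then left Kan extension along [F]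
    is computed by precomposition with [G]: [(L, η')] is a left Kan extension
    of [H] along [F] as soon as the canonical comparison
    [L ε_d ∘ η'_(G d) : H (G d) -> L d] is invertible for every [d]
    ([is_left_kan_of_comparison]). For [(G, η)] and for [(F G, F η)] this
    comparison is [G ε_d ∘ η_(G d)], respectively its image under [F], so it is
    an identity by a triangle identity.

    Conversely, suppose that [(G, η)] and [(F G, F η)] are left Kan extensions
    along [F] of [id] and of [F]. Factoring the identity transformation of [F]
    through [F η] produces a counit [ε : F G ⇒ id] and, at the same time, the
    triangle identity [ε_(F c) ∘ F η_c = id] ([kan_counit]). The other triangle
    identity says that the endomorphism [d ↦ G ε_d ∘ η_(G d)] of [G] is the
    identity, and the uniqueness part of the universal property of [(G, η)]
    reduces this to a comparison after composing with [η]
    ([kan_triangle_right]). Unit and counit then give the adjunction. *)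

(* Composite and identity functors leave their object maps folded in the type
   of a naturality square; [simpl] brings it to the form met in the goal. *)
Ltac rewrite_square t :=
  let n := fresh in pose proof t as n; simpl in n |- *; rewrite n; clear n.

(** Uniqueness in [is_left_kan] is Leibniz equality of transformations, whose
    fields include proofs: it needs extensionality and proof irrelevance. *)
Lemma nat_trans_ext (C D : category) (F G : functor C D) (a b : F ⇒ G) :
  (forall x, a x = b x) -> a = b.
Proof.
destruct a as [a na], b as [b nb]; simpl; intro e.
assert (e' : a = b) by (now apply functional_extensionality_dep).
subst b; f_equal; apply proof_irrelevance.
Qed.

(** * From an adjunction to Kan extensions *)

Definition adj_counit (C D : category) (F : functor C D) (G : functor D C)
    (A : adjunction F G) (d : D) : hom (F (G d)) d :=
  untranspose A (idm (G d)).

Lemma transpose_unit (C D : category) (F : functor C D) (G : functor D C)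
    (A : adjunction F G) (c : C) (d : D) (f : hom (F c) d) :
  transpose A f = fmap G f ∘ adj_unit A c.
Proof. now simpl; rewrite <- transpose_natr, comp_idr. Qed.

Lemma transpose_inj (C D : category) (F : functor C D) (G : functor D C)
    (A : adjunction F G) (c : C) (d : D) (f g : hom (F c) d) :
  transpose A f = transpose A g -> f = g.
Proof.
now intro e; rewrite <- (transposeK A f), e, transposeK.
Qed.

Lemma adj_counit_naturality (C D : category) (F : functor C D)
    (G : functor D C) (A : adjunction F G) (d d' : D) (v : hom d d') :
  adj_counit A d' ∘ fmap F (fmap G v) = v ∘ adj_counit A d.
Proof.
apply (transpose_inj (A := A)); unfold adj_counit.
now rewrite transpose_natl, transpose_natr, !untransposeK, comp_idl, comp_idr.
Qed.

Lemma adj_triangle_left (C D : category) (F : functor C D) (G : functor D C)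
    (A : adjunction F G) (c : C) :
  adj_counit A (F c) ∘ fmap F (adj_unit A c) = idm (F c).
Proof.
apply (transpose_inj (A := A)); unfold adj_counit.
now rewrite transpose_natl, untransposeK, comp_idl.
Qed.

Lemma adj_triangle_right (C D : category) (F : functor C D) (G : functor D C)
    (A : adjunction F G) (d : D) :
  fmap G (adj_counit A d) ∘ adj_unit A (G d) = idm (G d).
Proof.
rewrite <- transpose_unit; apply untransposeK.
Qed.

(** The canonical map [H (R d) -> L d] by which the extension [H R] along a
    left adjoint [K ⊣ R] is compared with another candidate [(L, η)]. *)
Definition kan_comparison (C D E : category) (K : functor C D)
    (R : functor D C) (A : adjunction K R) (H : functor C E) (L : functor D E)
    (eta : H ⇒ L ∘F K) (d : D) : hom (H (R d)) (L d) :=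
  fmap L (adj_counit A d) ∘ eta (R d).

Section Comparison.

Variables (C D E : category) (K : functor C D) (R : functor D C).
Variables (A : adjunction K R) (H : functor C E).

Lemma kan_comparison_naturality (L : functor D E) (eta : H ⇒ L ∘F K)
    (d d' : D) (v : hom d d') :
  kan_comparison A eta d' ∘ fmap H (fmap R v)
  = fmap L v ∘ kan_comparison A eta d.
Proof.
unfold kan_comparison.
rewrite <- comp_assoc; rewrite_square (naturality eta (fmap R v)).
now rewrite !comp_assoc, <- !fmap_comp, adj_counit_naturality.
Qed.

(** The transformation [η] is recovered from its comparison maps, by the
    triangle identity on the left adjoint. *)
Lemma kan_comparison_unit (L : functor D E) (eta : H ⇒ L ∘F K) (c : C) :
  kan_comparison A eta (K c) ∘ fmap H (adj_unit A c) = eta c.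
Proof.
unfold kan_comparison.
rewrite <- comp_assoc; rewrite_square (naturality eta (adj_unit A c)).
rewrite comp_assoc, <- fmap_comp.
rewrite_square (adj_triangle_left A c); rewrite fmap_id.
apply comp_idl.
Qed.

Lemma kan_comparison_factor (L L' : functor D E) (eta : H ⇒ L ∘F K)
    (a : L ⇒ L') (d : D) :
  kan_comparison A (nt_comp (nt_restrict a K) eta) d
  = a d ∘ kan_comparison A eta d.
Proof.
unfold kan_comparison; simpl.
now rewrite !comp_assoc, naturality.
Qed.

Section Inverse.

Variables (L : functor D E) (eta : H ⇒ L ∘F K).
Variable s : forall d, hom (L d) (H (R d)).
Hypothesis comparison_s : forall d, kan_comparison A eta d ∘ s d = idm (L d).
Hypothesis s_comparison :
  forall d, s d ∘ kan_comparison A eta d = idm (H (R d)).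

Lemma comparison_inverse_naturality (d d' : D) (v : hom d d') :
  s d' ∘ fmap L v = fmap H (fmap R v) ∘ s d.
Proof.
rewrite <- (comp_idr (fmap L v)), <- comparison_s.
rewrite (comp_assoc (fmap L v)), <- kan_comparison_naturality.
now rewrite !comp_assoc, s_comparison, comp_idl.
Qed.

Lemma kan_factor_naturality (L' : functor D E) (eta' : H ⇒ L' ∘F K)
    (d d' : D) (v : hom d d') :
  (kan_comparison A eta' d' ∘ s d') ∘ fmap L v
  = fmap L' v ∘ (kan_comparison A eta' d ∘ s d).
Proof.
rewrite <- comp_assoc, comparison_inverse_naturality, comp_assoc.
now rewrite kan_comparison_naturality, comp_assoc.
Qed.

(** A factorization [η' = a_K ∘ η] multiplies comparison maps by [a], so [a]
    must be the comparison map of [η'] composed with the inverse of that of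
    [η]; and this choice works since a transformation is recovered from its
    comparison maps. *)
Lemma is_left_kan_of_comparison : is_left_kan eta.
Proof.
intros L' eta'.
exists (NatTrans (F := L) (G := L') (kan_factor_naturality eta')).
split.
- apply nat_trans_ext; intro c; simpl.
  rewrite <- (kan_comparison_unit eta c).
  (* the inverse cancels the comparison map of [eta] *)
  rewrite <- comp_assoc, (comp_assoc (s (K c))), s_comparison, comp_idl.
  symmetry; apply kan_comparison_unit.
- intros a ->; apply nat_trans_ext; intro d; simpl.
  now rewrite kan_comparison_factor, <- comp_assoc, comparison_s, comp_idr.
Qed.

End Inverse.

End Comparison.

Lemma adj_unit_is_left_kan (C D : category) (F : functor C D)
    (G : functor D C) (A : adjunction F G) : is_left_kan (adj_unit A).
Proof.
assert (e : forall d, kan_comparison A (adj_unit A) d = idm (G d))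
  by apply adj_triangle_right.
apply (is_left_kan_of_comparison (A := A) (eta := adj_unit A)
         (s := fun d => idm (G d)));
  intro d; rewrite e; apply comp_idl.
Qed.

(** Every functor out of [C], not only [F], preserves this extension: it
    preserves the triangle identity. *)
Lemma adj_unit_preserved (C D E : category) (F : functor C D)
    (G : functor D C) (A : adjunction F G) (H : functor C E) :
  preserves_left_kan H (adj_unit A).
Proof.
assert (e : forall d, kan_comparison A (nt_image H (adj_unit A)) d
                      = idm (H (G d))).
{ intro d; unfold kan_comparison; simpl.
  rewrite <- fmap_comp; rewrite_square (adj_triangle_right A d).
  apply fmap_id. }
apply (is_left_kan_of_comparison (A := A) (eta := nt_image H (adj_unit A))
         (s := fun d => idm (H (G d))));
  intro d; rewrite e; apply comp_idl.
Qed.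

(** * From Kan extensions to an adjunction *)

Lemma adjunction_of_triangles (C D : category) (F : functor C D)
    (G : functor D C) (eta : functor_id C ⇒ G ∘F F)
    (eps : F ∘F G ⇒ functor_id D) :
  (forall c, eps (F c) ∘ fmap F (eta c) = idm (F c)) ->
  (forall d, fmap G (eps d) ∘ eta (G d) = idm (G d)) ->
  exists A : adjunction F G, adj_unit A = eta.
Proof.
intros tl tr.
unshelve eexists (@Adjunction C D F G
  (fun c d f => fmap G f ∘ eta c) (fun c d g => eps d ∘ fmap F g) _ _ _ _).
- intros c d f; simpl.
  rewrite fmap_comp, comp_assoc; rewrite_square (naturality eps f).
  rewrite <- comp_assoc; rewrite_square (tl c); apply comp_idr.
- intros c d g; simpl.
  rewrite fmap_comp, <- comp_assoc; rewrite_square (eq_sym (naturality eta g)).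
  rewrite comp_assoc; rewrite_square (tr d); apply comp_idl.
- intros c c' d u f; simpl.
  rewrite fmap_comp, <- comp_assoc; rewrite_square (eq_sym (naturality eta u)).
  apply comp_assoc.
- intros c d d' v f; simpl.
  now rewrite fmap_comp, comp_assoc.
- apply nat_trans_ext; intro c; simpl.
  rewrite fmap_id; apply comp_idl.
Qed.

Lemma idm_naturality (C D : category) (F : functor C D) (x y : C)
    (f : hom x y) :
  idm (F y) ∘ fmap (F ∘F functor_id C) f
  = fmap (functor_id D ∘F F) f ∘ idm (F x).
Proof. simpl; now rewrite comp_idl, comp_idr. Qed.

(** The identity transformation of [F], with the domain and codomain for which
    the universal property of [F η] yields a transformation [F G ⇒ id]. *)
Definition nt_unitor (C D : category) (F : functor C D) :
    F ∘F functor_id C ⇒ functor_id D ∘F F :=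
  NatTrans (F := F ∘F functor_id C) (G := functor_id D ∘F F)
    (component := fun x => idm (F x)) (idm_naturality F).

Lemma kan_counit (C D : category) (F : functor C D) (G : functor D C)
    (eta : functor_id C ⇒ G ∘F F) :
  preserves_left_kan F eta ->
  exists eps : F ∘F G ⇒ functor_id D,
    forall c, eps (F c) ∘ fmap F (eta c) = idm (F c).
Proof.
intro kanF; destruct (kanF (functor_id D) (nt_unitor F)) as [eps [e _]].
exists eps; intro c; symmetry.
exact (f_equal (fun t : F ∘F functor_id C ⇒ functor_id D ∘F F => t c) e).
Qed.

Lemma is_left_kan_endo_id (C D E : category) (K : functor C D)
    (F : functor C E) (G : functor D E) (eta : F ⇒ G ∘F K) (a : G ⇒ G) :
  is_left_kan eta -> (forall c, a (K c) ∘ eta c = eta c) ->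
  forall d, a d = idm (G d).
Proof.
intros kan fix_eta d.
assert (n : forall x y (f : hom x y),
          idm (G y) ∘ fmap G f = fmap G f ∘ idm (G x))
  by (intros; now rewrite comp_idl, comp_idr).
destruct (kan G eta) as [b [_ uniq]].
enough (e : a = NatTrans n) by (now rewrite e).
transitivity b; [symmetry |]; apply uniq; apply nat_trans_ext; intro c; simpl.
- symmetry; apply fix_eta.
- symmetry; apply comp_idl.
Qed.

(** The endomorphism [d ↦ G ε_d ∘ η_(G d)] of [G] fixes [η]: naturality of [η]
    at [η_c] turns [η_(G F c) ∘ η_c] into [G F η_c ∘ η_c], and the first
    triangle identity applies under [G]. *)
Lemma kan_triangle_right (C D : category) (F : functor C D) (G : functor D C)
    (eta : functor_id C ⇒ G ∘F F) (eps : F ∘F G ⇒ functor_id D) :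
  is_left_kan eta ->
  (forall c, eps (F c) ∘ fmap F (eta c) = idm (F c)) ->
  forall d, fmap G (eps d) ∘ eta (G d) = idm (G d).
Proof.
intros kan tl.
assert (n : forall x y (f : hom x y),
          (fmap G (eps y) ∘ eta (G y)) ∘ fmap G f
          = fmap G f ∘ (fmap G (eps x) ∘ eta (G x))).
{ intros x y f.
  rewrite <- comp_assoc; rewrite_square (naturality eta (fmap G f)).
  rewrite !comp_assoc, <- !fmap_comp.
  now rewrite_square (naturality eps f). }
apply (is_left_kan_endo_id (a := NatTrans (F := G) (G := G) n) kan).
intro c; simpl.
rewrite <- comp_assoc; rewrite_square (naturality eta (eta c)).
rewrite comp_assoc, <- fmap_comp; rewrite_square (tl c); rewrite fmap_id.
apply comp_idl.
Qed.

Theorem theorem1p8 (C D : category) (F : functor C D) (G : functor D C) :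
  (is_right_adjoint G F <->
   exists eta : functor_id C ⇒ G ∘F F,
     is_left_kan eta /\ preserves_left_kan F eta) /\
  (forall eta : functor_id C ⇒ G ∘F F,
     is_left_kan eta -> preserves_left_kan F eta ->
     exists A : adjunction F G, adj_unit A = eta).
Proof.
assert (back : forall eta : functor_id C ⇒ G ∘F F,
          is_left_kan eta -> preserves_left_kan F eta ->
          exists A : adjunction F G, adj_unit A = eta).
{ intros eta kan kanF.
  destruct (kan_counit kanF) as [eps tl].
  exact (adjunction_of_triangles tl (kan_triangle_right kan tl)). }
split; [split | exact back].
- intros [A]; exists (adj_unit A); split.
  + apply adj_unit_is_left_kan.
  + apply adj_unit_preserved.
- intros [eta [kan kanF]].
  destruct (back eta kan kanF) as [A _]; exact (inhabits A).
Qed.
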